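(* For every $n\in\mathbb N$ (with $n\ge 1$) let $\mathcal{A}_n:=(\ell^1(BC,\omega_n),\ast)$, where $BC$ is the bicyclic monoid and $\omega_n$ is the weight on $BC$ with $\omega_n(e)=1$ and $\omega_n(s)=n$ for $s\in BC\setminus\{e\}$. Then $(\mathcal{A}_n)$ is a sequence of Dedekind-infinite Banach algebras such that $\mathrm{Asy}(\mathcal{A}_n)$ is Dedekind-finite.
   Context: The bicyclic monoid is $BC=\langle p,q : pq=e\rangle$, i.e. the monoid with unit $e$ generated by $p,q$ subject to the single relation $pq=e$. A weight on a monoid $S$ with unit $e$ is a function $\omega:S\to(0,+\infty)$ with $\omega(st)\le\omega(s)\omega(t)$ for all $s,t\in S$ and $\omega(e)=1$. For such $\omega$, $\ell^1(S,\omega)$ is the Banach space of functions $f:S\to\mathbb C$ with $\|f\|_\omega=\sum_{s\in S}|f(s)|\omega(s)<\infty$; with the convolution product $(f\ast g)(r)=\sum_{st=r}f(s)g(t)$ it is a unital Banach algebra with unit $\delta_e$ of norm $1$. For a sequence $(\mathcal A_n)$ of Banach algebras, $\ell^\infty(\mathcal A_n)$ is the Banach algebra of all bounded sequences $(a_n)$ with $a_n\in\mathcal A_n$, with pointwise operations and the supremum norm; $c_0(\mathcal A_n)$ is the closed two-sided ideal of sequences with $\lim_{n\to\infty}\|a_n\|=0$; and $\mathrm{Asy}(\mathcal A_n)=\ell^\infty(\mathcal A_n)/c_0(\mathcal A_n)$ with the quotient norm. Two idempotents $p,q$ in an algebra $\mathcal A$ are equivalent, $p\sim q$, if there are $a,b\in\mathcal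 A$ with $p=ab$ and $q=ba$. A unital algebra $\mathcal A$ is Dedekind-finite if every idempotent $p\in\mathcal A$ with $p\sim 1$ satisfies $p=1$; otherwise it is Dedekind-infinite. *)

(* Defs.v *)
From HB Require Import structures.
From mathcomp Require Import all_boot all_order all_algebra.
From mathcomp Require Import finmap.
From mathcomp Require Import all_classical all_reals ereal topology normedtype.
From mathcomp Require Import sequences esum numfun realfun.
From mathcomp Require Import complex.
From mathcomp Require Import ring lra.
Set Implicit Arguments.
Unset Strict Implicit.
Unset Printing Implicit Defensive.
Import Order.TTheory GRing.Theory Num.Theory.
Import numFieldNormedType.Exports.
Import ComplexField.Normc.
Local Open Scope classical_set_scope.
Local Open Scope ring_scope.
Local Open Scope complex_scope.
Local Open Scope quotient_scope.
Lemma normc_ge0 (R : rcfType) (z : R[i]) : 0 <= normc z.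
Proof. by case: z => x y; exact: sqrtr_ge0. Qed.

Definition idempotent_elt (A : pzRingType) (p : A) := p * p = p.

Definition idempotent_equiv (A : pzRingType) (p q : A) :=
  exists a b : A, p = a * b /\ q = b * a.

Definition dedekind_finite (A : pzRingType) :=
  forall p : A, idempotent_elt p -> idempotent_equiv p 1 -> p = 1.

Definition dedekind_infinite (A : pzRingType) := ~ dedekind_finite A.

(* Unital complex Banach algebras. This is a plain record because the MathComp
   hierarchy has no join of normed modules with algebras, and none can be
   declared a posteriori (numDomainType already inherits from both). *)
Record unitalBanachAlg (R : realType) := UnitalBanachAlg {
  ba_sort :> algType R[i];
  ba_norm : ba_sort -> R;
  ba_norm_eq0 : forall x, ba_norm x = 0 -> x = 0;
  ba_normD : forall x y, ba_norm (x + y) <= ba_norm x + ba_norm y;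
  ba_normZ : forall k x, ba_norm (k *: x) = normc k * ba_norm x;
  ba_normM : forall x y, ba_norm (x * y) <= ba_norm x * ba_norm y;
  ba_norm1 : ba_norm 1 = 1;
  ba_complete : forall u : nat -> ba_sort,
    (forall e : R, 0 < e -> exists N, forall m n,
       (N <= m)%N -> (N <= n)%N -> ba_norm (u m - u n) < e) ->
    exists l, ba_norm (u n - l) @[n --> \oo] --> (0 : R)
}.

Section UnitalBanachAlgTheory.
Context {R : realType} {A : unitalBanachAlg R}.
Implicit Types x y : A.

Lemma ba_norm0 : ba_norm (0 : A) = 0.
Proof. by rewrite -(scale0r (0 : A)) ba_normZ normc0 mul0r. Qed.

Lemma ba_normN x : ba_norm (- x) = ba_norm x.
Proof.
rewrite -scaleN1r ba_normZ.
by rewrite normcN normc1 mul1r.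
Qed.

Lemma ba_norm_ge0 x : 0 <= ba_norm x.
Proof.
have := ba_normD x (- x); rewrite subrr ba_norm0 ba_normN.
by rewrite -mulr2n pmulrn_lge0.
Qed.

End UnitalBanachAlgTheory.

Section Asy.
Context {R : realType} (A : nat -> unitalBanachAlg R).

(* All sequences a with a n in A n; linfty is cut out of it below. *)
Definition seqprod := forall n, A n.

HB.instance Definition _ := gen_eqMixin seqprod.
HB.instance Definition _ := gen_choiceMixin seqprod.

Implicit Types a b c : seqprod.

Let ext a b : (forall n, a n = b n) -> a = b.
Proof. exact: functional_extensionality_dep. Qed.

Definition sp_add a b : seqprod := fun n => a n + b n.
Definition sp_opp a : seqprod := fun n => - a n.
Definition sp_zero : seqprod := fun n => 0.
Definition sp_mul a b : seqprod := fun n => a n * b n.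
Definition sp_one : seqprod := fun n => 1.
Definition sp_scale (k : R[i]) a : seqprod := fun n => k *: a n.

Let sp_addA : associative sp_add.
Proof. by move=> a b c; apply: ext => n; exact: addrA. Qed.
Let sp_addC : commutative sp_add.
Proof. by move=> a b; apply: ext => n; exact: addrC. Qed.
Let sp_add0 : left_id sp_zero sp_add.
Proof. by move=> a; apply: ext => n; exact: add0r. Qed.
Let sp_addN : left_inverse sp_zero sp_opp sp_add.
Proof. by move=> a; apply: ext => n; exact: addNr. Qed.

HB.instance Definition _ :=
  GRing.isZmodule.Build seqprod sp_addA sp_addC sp_add0 sp_addN.

Let sp_mulA : associative sp_mul.
Proof. by move=> a b c; apply: ext => n; exact: mulrA. Qed.
Let sp_mul1l : left_id sp_one sp_mul.
Proof. by move=> a; apply: ext => n; exact: mul1r. Qed.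
Let sp_mul1r : right_id sp_one sp_mul.
Proof. by move=> a; apply: ext => n; exact: mulr1. Qed.
Let sp_mulDl : left_distributive sp_mul +%R.
Proof. by move=> a b c; apply: ext => n; exact: mulrDl. Qed.
Let sp_mulDr : right_distributive sp_mul +%R.
Proof. by move=> a b c; apply: ext => n; exact: mulrDr. Qed.
Let sp_one_neq0 : sp_one != 0.
Proof.
by apply/eqP => /(congr1 (fun f : seqprod => f 0%N))/eqP; rewrite oner_eq0.
Qed.

HB.instance Definition _ := GRing.Zmodule_isNzRing.Build seqprod
  sp_mulA sp_mul1l sp_mul1r sp_mulDl sp_mulDr sp_one_neq0.

Let sp_scaleA j k a : sp_scale j (sp_scale k a) = sp_scale (j * k) a.
Proof. by apply: ext => n; exact: scalerA. Qed.
Let sp_scale1 : left_id 1 sp_scale.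
Proof. by move=> a; apply: ext => n; exact: scale1r. Qed.
Let sp_scaleDr : right_distributive sp_scale +%R.
Proof. by move=> k a b; apply: ext => n; exact: scalerDr. Qed.
Let sp_scaleDl a : {morph sp_scale^~ a : j k / j + k}.
Proof. by move=> j k; apply: ext => n; exact: scalerDl. Qed.

HB.instance Definition _ := GRing.Zmodule_isLmodule.Build R[i] seqprod
  sp_scaleA sp_scale1 sp_scaleDr sp_scaleDl.

Let sp_scaleAl (k : R[i]) a b : k *: (a * b) = k *: a * b.
Proof. by apply: ext => n; exact: scalerAl. Qed.

HB.instance Definition _ :=
  GRing.Lmodule_isLalgebra.Build R[i] seqprod sp_scaleAl.

Let sp_scaleAr (k : R[i]) a b : k *: (a * b) = a * (k *: b).
Proof. by apply: ext => n; exact: scalerAr. Qed.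

HB.instance Definition _ :=
  GRing.Lalgebra_isAlgebra.Build R[i] seqprod sp_scaleAr.

Definition bounded_seq : {pred seqprod} :=
  fun a => `[< exists M : R, forall n, ba_norm (a n) <= M >].

Let bounded_seq_closed : GRing.subsemialg_closed bounded_seq.
Proof.
split.
- by apply/asboolP; exists 1 => n; rewrite ba_norm1.
- split; first by apply/asboolP; exists 0 => n; rewrite ba_norm0.
  move=> a b /asboolP[M aM] /asboolP[N bN]; apply/asboolP.
  by exists (M + N) => n; rewrite (le_trans (ba_normD _ _))// lerD.
- move=> k a /asboolP[M aM]; apply/asboolP; exists (normc k * M) => n.
  by rewrite ba_normZ ler_wpM2l// normc_ge0.
- move=> a b /asboolP[M aM] /asboolP[N bN]; apply/asboolP.
  exists (M * N) => n; rewrite (le_trans (ba_normM _ _))//.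
  by rewrite ler_pM// ba_norm_ge0.
Qed.

Record linfty := Linfty { linfty_val : seqprod; _ : bounded_seq linfty_val }.

Definition linfty_fun (a : linfty) n : A n := linfty_val a n.
Coercion linfty_fun : linfty >-> Funclass.

HB.instance Definition _ := [isSub for linfty_val].
HB.instance Definition _ := [Choice of linfty by <:].
HB.instance Definition _ :=
  GRing.SubChoice_isSubAlgebra.Build R[i] seqprod bounded_seq linfty
    bounded_seq_closed.

Definition linfty_norm (a : linfty) : R := sup (range (fun n => ba_norm (a n))).

Definition c0 : {pred linfty} :=
  fun a : linfty => `[< ba_norm (a n) @[n --> \oo] --> (0 : R) >].

Let c0_zmod_closed : zmod_closed c0.
Proof.
split.
  apply/asboolP; rewrite (_ : (fun n => _) = fun=> 0); first exact: cvg_cst.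
  by apply/funext => n; exact: ba_norm0.
move=> a b /asboolP a0 /asboolP b0; apply/asboolP.
have ab0 : ba_norm (a n) + ba_norm (b n) @[n --> \oo] --> (0 : R).
  by rewrite -[0]addr0; exact: cvgD.
apply: (squeeze_cvgr _ (cvg_cst 0) ab0); apply: nearW => n.
by rewrite ba_norm_ge0/= (le_trans (ba_normD _ _))// ba_normN.
Qed.

HB.instance Definition _ := GRing.isZmodClosed.Build linfty c0 c0_zmod_closed.

Let linfty_bound (a : linfty) : exists M, forall n, ba_norm (a n) <= M.
Proof. by case: a => a /= /asboolP. Qed.

Lemma c0_idealMl (a b : linfty) : b \in c0 -> a * b \in c0.
Proof.
have [M aM] := linfty_bound a.
move=> /asboolP b0; apply/asboolP.
have Mb0 : M * ba_norm (b n) @[n --> \oo] --> (0 : R).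
  by rewrite -(mulr0 M); exact: cvgMr.
apply: (squeeze_cvgr _ (cvg_cst 0) Mb0); apply: nearW => n.
by rewrite ba_norm_ge0/= (le_trans (ba_normM _ _))// ler_wpM2r// ba_norm_ge0.
Qed.

Lemma c0_idealMr (a b : linfty) : a \in c0 -> a * b \in c0.
Proof.
have [M bM] := linfty_bound b.
move=> /asboolP a0; apply/asboolP.
have Ma0 : ba_norm (a n) * M @[n --> \oo] --> (0 : R).
  by rewrite -(mul0r M); exact: cvgMl.
apply: (squeeze_cvgr _ (cvg_cst 0) Ma0); apply: nearW => n.
by rewrite ba_norm_ge0/= (le_trans (ba_normM _ _))// ler_wpM2l// ba_norm_ge0.
Qed.

Let c0_scale (k : R[i]) (a : linfty) : a \in c0 -> k *: a \in c0.
Proof. by move=> a0; rewrite -mulr_algl c0_idealMl. Qed.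

Let one_notin_c0 : (1 : linfty) \notin c0.
Proof.
apply/negP => /asboolP.
rewrite (_ : (fun n => _) = fun=> 1); last first.
  by apply/funext => n; exact: ba_norm1.
move=> /cvg_lim; rewrite lim_cst// => /(_ (@norm_hausdorff _ _))/eqP.
by rewrite oner_eq0.
Qed.

(* {ideal_quot _} only provides a ring structure for commutative rings: the
   multiplication and the scaling of Asy are defined below. *)
Definition Asy := {ideal_quot c0}.

HB.instance Definition _ := GRing.Zmodule.on Asy.
HB.instance Definition _ := EqQuotient.on Asy.

Implicit Types x y z : Asy.

Let asyP (a b : linfty) : a - b \in c0 -> \pi_Asy a = \pi_Asy b.
Proof. by rewrite Quotient.idealrBE => /eqP. Qed.

Let asy_repr (a : linfty) : repr (\pi_Asy a) - a \in c0.
Proof. by rewrite Quotient.idealrBE reprK. Qed.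

Let asyD (a b : linfty) : \pi_Asy (a + b) = \pi_Asy a + \pi_Asy b.
Proof. by rewrite !piE. Qed.

Definition asy_one : Asy := \pi_Asy 1.
Definition asy_mul x y : Asy := \pi_Asy (repr x * repr y).
Definition asy_scale (k : R[i]) x : Asy := \pi_Asy (k *: repr x).

Let asyM (a b : linfty) : asy_mul (\pi_Asy a) (\pi_Asy b) = \pi_Asy (a * b).
Proof.
apply: asyP; set u := repr _; set v := repr _.
rewrite (_ : u * v - a * b = (u - a) * v + a * (v - b)); last first.
  by rewrite mulrBl mulrBr addrA subrK.
by apply: rpredD; [apply: c0_idealMr|apply: c0_idealMl]; exact: asy_repr.
Qed.

Let asyZ (k : R[i]) (a : linfty) : asy_scale k (\pi_Asy a) = \pi_Asy (k *: a).
Proof. by apply: asyP; rewrite -scalerBr c0_scale//; exact: asy_repr. Qed.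

Let asy_mulA : associative asy_mul.
Proof.
elim/quotW => a; elim/quotW => b; elim/quotW => c.
by rewrite (asyM b c) (asyM a b) !asyM mulrA.
Qed.
Let asy_mul1l : left_id asy_one asy_mul.
Proof. by elim/quotW => a; rewrite asyM mul1r. Qed.
Let asy_mul1r : right_id asy_one asy_mul.
Proof. by elim/quotW => a; rewrite asyM mulr1. Qed.
Let asy_mulDl : left_distributive asy_mul +%R.
Proof.
elim/quotW => a; elim/quotW => b; elim/quotW => c.
by rewrite (asyM a c) (asyM b c) -!asyD asyM mulrDl.
Qed.
Let asy_mulDr : right_distributive asy_mul +%R.
Proof.
elim/quotW => a; elim/quotW => b; elim/quotW => c.
by rewrite (asyM a b) (asyM a c) -!asyD asyM mulrDr.
Qed.
Let asy_one_neq0 : asy_one != 0.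
Proof.
by rewrite /asy_one piE Quotient.equivE subr0.
Qed.

HB.instance Definition _ := GRing.Zmodule_isNzRing.Build Asy
  asy_mulA asy_mul1l asy_mul1r asy_mulDl asy_mulDr asy_one_neq0.

Let asy_scaleA j k x : asy_scale j (asy_scale k x) = asy_scale (j * k) x.
Proof. by elim/quotW: x => a; rewrite (asyZ k a) !asyZ scalerA. Qed.
Let asy_scale1 : left_id 1 asy_scale.
Proof. by elim/quotW => a; rewrite asyZ scale1r. Qed.
Let asy_scaleDr : right_distributive asy_scale +%R.
Proof.
by move=> k; elim/quotW => a; elim/quotW => b; rewrite (asyZ k a) (asyZ k b) -!asyD asyZ scalerDr.
Qed.
Let asy_scaleDl x : {morph asy_scale^~ x : j k / j + k}.
Proof. by elim/quotW: x => a j k; rewrite (asyZ j a) (asyZ k a) (asyZ (j + k) a) -asyD scalerDl. Qed.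

HB.instance Definition _ := GRing.Zmodule_isLmodule.Build R[i] Asy
  asy_scaleA asy_scale1 asy_scaleDr asy_scaleDl.

Let asy_scaleAl (k : R[i]) x y : k *: (x * y) = k *: x * y.
Proof.
elim/quotW: x => a; elim/quotW: y => b.
rewrite -[LHS]/(asy_scale k (asy_mul _ _)) -[RHS]/(asy_mul (asy_scale k _) _).
by rewrite (asyM a b) (asyZ k a) (asyM (k *: a) b) asyZ scalerAl.
Qed.

HB.instance Definition _ :=
  GRing.Lmodule_isLalgebra.Build R[i] Asy asy_scaleAl.

Let asy_scaleAr (k : R[i]) x y : k *: (x * y) = x * (k *: y).
Proof.
elim/quotW: x => a; elim/quotW: y => b.
rewrite -[LHS]/(asy_scale k (asy_mul _ _)) -[RHS]/(asy_mul _ (asy_scale k _)).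
by rewrite (asyM a b) (asyZ k b) (asyM a (k *: b)) asyZ scalerAr.
Qed.

HB.instance Definition _ :=
  GRing.Lalgebra_isAlgebra.Build R[i] Asy asy_scaleAr.

Lemma pi_asy1 : \pi_Asy 1 = 1.
Proof. by []. Qed.

Lemma pi_asyM (a b : linfty) : \pi_Asy (a * b) = \pi_Asy a * \pi_Asy b.
Proof. by rewrite -asyM. Qed.

Lemma pi_asyZ (k : R[i]) (a : linfty) : \pi_Asy (k *: a) = k *: \pi_Asy a.
Proof. by rewrite -asyZ. Qed.

Lemma pi_asyB (a b : linfty) : \pi_Asy (a - b) = \pi_Asy a - \pi_Asy b.
Proof. by rewrite !piE. Qed.

Lemma pi_asy_eq (a b : linfty) : \pi_Asy a = \pi_Asy b <-> a - b \in c0.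
Proof. by rewrite Quotient.idealrBE; split => [->|/eqP]. Qed.

(* The quotient norm. *)
Definition asy_norm x : R :=
  inf [set linfty_norm a | a in [set a : linfty | \pi_Asy a = x]].

End Asy.

Section rsum.
Context {R : realType}.
Implicit Types T : choiceType.

(* rsum D g and csum D f are the (unordered) sums over D of an absolutely
   summable real, resp. complex, family; \esum only sums nonnegative ones. *)
Definition rsum T (D : set T) (g : T -> R) : R :=
  fine (\esum_(x in D) (Num.max (g x) 0)%:E)
  - fine (\esum_(x in D) (Num.max (- g x) 0)%:E).

Definition csum T (D : set T) (f : T -> R[i]) : R[i] :=
  rsum D (fun x => complex.Re (f x)) +i* rsum D (fun x => complex.Im (f x)).

Lemma esum_fin T (D : set T) (g : T -> R) : (forall x, D x -> 0 <= g x) ->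
  (\esum_(x in D) (g x)%:E < +oo)%E -> \esum_(x in D) (g x)%:E \is a fin_num.
Proof. by move=> g0 goo; rewrite ge0_fin_numE// esum_ge0. Qed.

Lemma esum_le_bound T (D : set T) (a : T -> R) (M : R) :
  (forall X : set T, finite_set X -> X `<=` D -> \sum_(x \in X) a x <= M) ->
  (\esum_(x in D) (a x)%:E <= M%:E)%E.
Proof.
move=> aM; apply: ge_ereal_sup => _ [X [finX XD] <-].
by rewrite fsumEFin// lee_fin aM.
Qed.

Lemma esum_bound T (D X : set T) (a : T -> R) (M : R) :
  (\esum_(x in D) (a x)%:E <= M%:E)%E ->
  finite_set X -> X `<=` D -> \sum_(x \in X) a x <= M.
Proof.
move=> aM finX XD; rewrite -lee_fin -fsumEFin//; apply: le_trans aM.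
by apply: esum_ge; exists X.
Qed.

Lemma le_esumZ T (D : set T) (a : T -> R) (c M : R) : 0 <= c ->
  (\esum_(x in D) (a x)%:E <= M%:E)%E ->
  (\esum_(x in D) (c * a x)%:E <= (c * M)%:E)%E.
Proof.
move=> c0 aM; apply: esum_le_bound => X finX XD.
by rewrite -mulr_fsumr ler_wpM2l// (esum_bound aM).
Qed.

Lemma esum_ltZ T (D : set T) (a : T -> R) (c : R) : 0 <= c ->
  (forall x, D x -> 0 <= a x) -> (\esum_(x in D) (a x)%:E < +oo)%E ->
  (\esum_(x in D) (c * a x)%:E < +oo)%E.
Proof.
move=> c0 a0 aoo; have afin := esum_fin a0 aoo.
have /le_lt_trans -> // : (\esum_(x in D) (c * a x)%:E <=
    (c * fine (\esum_(x in D) (a x)%:E))%:E)%E by rewrite le_esumZ// fineK.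
exact: ltry.
Qed.

Lemma esum_prod_le T1 T2 (a : T1 -> R) (b : T2 -> R) (M N : R) :
  (forall x, 0 <= a x) -> (forall y, 0 <= b y) ->
  (\esum_(x in [set: T1]) (a x)%:E <= M%:E)%E ->
  (\esum_(y in [set: T2]) (b y)%:E <= N%:E)%E ->
  (\esum_(k in [set: T1 * T2]) (a k.1 * b k.2)%:E <= (M * N)%:E)%E.
Proof.
move=> a0 b0 aM bN.
have N0 : 0 <= N.
  by rewrite -lee_fin; apply: le_trans bN; apply: esum_ge0 => y _; rewrite lee_fin.
rewrite (_ : setT = setT `*`` (fun=> setT)); last by apply/seteqP; split.
rewrite -(@esum_esum _ _ _ setT (fun=> setT) (fun x y => (a x * b y)%:E)%E);
  last by move=> x y _ _; rewrite lee_fin mulr_ge0.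
rewrite mulrC; apply: le_trans (le_esumZ N0 aM).
by apply: le_esum => x _; rewrite mulrC; exact: le_esumZ.
Qed.

Lemma eq_rsum T (D : set T) (g h : T -> R) :
  (forall x, D x -> g x = h x) -> rsum D g = rsum D h.
Proof.
by move=> gh; congr (fine _ - fine _); apply: eq_esum => x Dx; rewrite gh.
Qed.

Lemma rsumE T (D : set T) (p n g : T -> R) :
  (forall x, D x -> 0 <= p x) -> (forall x, D x -> 0 <= n x) ->
  (\esum_(x in D) (p x)%:E < +oo)%E -> (\esum_(x in D) (n x)%:E < +oo)%E ->
  (forall x, D x -> g x = p x - n x) ->
  rsum D g = fine (\esum_(x in D) (p x)%:E) - fine (\esum_(x in D) (n x)%:E).
Proof.
move=> p0 n0 poo noo gE.
have max0 (y : R) : 0 <= Num.max y 0 by rewrite le_max lexx orbT.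
have pos : (\esum_(x in D) (Num.max (g x) 0)%:E < +oo)%E.
  apply: le_lt_trans poo; apply: le_esum => x Dx.
  by rewrite lee_fin ge_max p0// gE// lerBlDr lerDl n0.
have neg : (\esum_(x in D) (Num.max (- g x) 0)%:E < +oo)%E.
  apply: le_lt_trans noo; apply: le_esum => x Dx.
  by rewrite lee_fin ge_max n0// gE// opprB lerBlDr lerDl p0.
have E : (\esum_(x in D) (Num.max (g x) 0)%:E + \esum_(x in D) (n x)%:E =
    \esum_(x in D) (p x)%:E + \esum_(x in D) (Num.max (- g x) 0)%:E)%E.
  rewrite -esumD; last 2 first.
  - by move=> x Dx; rewrite lee_fin max0.
  - by move=> x Dx; rewrite lee_fin n0.
  rewrite -esumD; last 2 first.
  - by move=> x Dx; rewrite lee_fin p0.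
  - by move=> x Dx; rewrite lee_fin max0.
  apply: eq_esum => x Dx; rewrite -!EFinD; congr EFin; rewrite gE// opprB.
  case: (leP (p x) (n x)) => pn.
    rewrite max_r ?subr_le0// max_l ?subr_ge0// add0r.
    by rewrite addrC subrK.
  by rewrite max_l ?subr_ge0 ?ltW// max_r ?subr_le0 ?ltW// addr0 subrK.
move: E; move: pos neg poo noo.
move=> /(esum_fin (fun x _ => max0 _)) + /(esum_fin (fun x _ => max0 _)).
move=> + + /(esum_fin p0) + /(esum_fin n0).
rewrite /rsum; move: (esum _ _) (esum _ _) (esum _ _) (esum _ _).
move=> [a||] // [b||] // [c||] // [d||] //= _ _ _ _ []; lra.
Qed.

Definition rsummable T (D : set T) (g : T -> R) :=
  (\esum_(x in D) `|g x|%:E < +oo)%E.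

Let max0 (y : R) : 0 <= Num.max y 0. Proof. by rewrite le_max lexx orbT. Qed.

Let maxE (y : R) : y = Num.max y 0 - Num.max (- y) 0.
Proof. by case: (leP y 0) => y0; case: (leP (- y) 0) => y1; lra. Qed.

Let rsummable_pos T (D : set T) g : rsummable D g ->
  (\esum_(x in D) (Num.max (g x) 0)%:E < +oo)%E.
Proof.
apply: le_lt_trans; apply: le_esum => x Dx.
by rewrite lee_fin ge_max normr_ge0 ler_norm.
Qed.

Let rsummable_neg T (D : set T) g : rsummable D g ->
  (\esum_(x in D) (Num.max (- g x) 0)%:E < +oo)%E.
Proof.
apply: le_lt_trans; apply: le_esum => x Dx.
by rewrite lee_fin ge_max normr_ge0 -normrN ler_norm.
Qed.

Let fineD_lt T (D : set T) (p q : T -> R) :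
  (forall x, D x -> 0 <= p x) -> (forall x, D x -> 0 <= q x) ->
  (\esum_(x in D) (p x)%:E < +oo)%E -> (\esum_(x in D) (q x)%:E < +oo)%E ->
  (\esum_(x in D) (p x + q x)%:E < +oo)%E /\
  fine (\esum_(x in D) (p x + q x)%:E) =
  fine (\esum_(x in D) (p x)%:E) + fine (\esum_(x in D) (q x)%:E).
Proof.
move=> p0 q0 poo qoo.
have -> : (\esum_(x in D) (p x + q x)%:E =
    \esum_(x in D) (p x)%:E + \esum_(x in D) (q x)%:E)%E.
  by rewrite -esumD.
by rewrite lte_add_pinfty// fineD// esum_fin.
Qed.

Lemma rsumD T (D : set T) (g h : T -> R) : rsummable D g -> rsummable D h ->
  rsum D (fun x => g x + h x) = rsum D g + rsum D h.
Proof.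
move=> gs hs.
have [ppoo ppE] := fineD_lt (fun x _ => max0 (g x)) (fun x _ => max0 (h x))
  (rsummable_pos gs) (rsummable_pos hs).
have [nnoo nnE] := fineD_lt (fun x _ => max0 (- g x)) (fun x _ => max0 (- h x))
  (rsummable_neg gs) (rsummable_neg hs).
rewrite (rsumE _ _ ppoo nnoo).
- by rewrite ppE nnE /rsum; lra.
- by move=> x _; rewrite addr_ge0.
- by move=> x _; rewrite addr_ge0.
- by move=> x _; rewrite {1}(maxE (g x)) {1}(maxE (h x)); lra.
Qed.

Lemma rsumN T (D : set T) (g : T -> R) :
  rsum D (fun x => - g x) = - rsum D g.
Proof.
rewrite /rsum opprB; congr (_ - fine _).
by apply: eq_esum => x Dx; rewrite opprK.
Qed.

Let fineZ T (D : set T) (a : T -> R) (c : R) : 0 <= c ->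
  (forall x, D x -> 0 <= a x) -> (\esum_(x in D) (a x)%:E < +oo)%E ->
  fine (\esum_(x in D) (c * a x)%:E) = c * fine (\esum_(x in D) (a x)%:E).
Proof.
move=> c0 a0 aoo.
have [->|cn0] := eqVneq c 0.
  by rewrite mul0r esum1// => x Dx; rewrite mul0r.
have c_gt0 : 0 < c by rewrite lt_neqAle eq_sym cn0.
have ca0 x : D x -> 0 <= c * a x by move=> Dx; rewrite mulr_ge0// a0.
have caoo := esum_ltZ c0 a0 aoo.
apply/eqP; rewrite eq_le; apply/andP; split.
  rewrite -lee_fin fineK ?esum_fin//; apply: le_esumZ => //.
  by rewrite fineK ?esum_fin.
rewrite -ler_pdivlMl// -lee_fin fineK ?esum_fin//.
rewrite (eq_esum (b := fun x => (c^-1 * (c * a x))%:E)); last first.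
  by move=> x Dx; rewrite mulKf.
apply: le_esumZ; first by rewrite invr_ge0.
by rewrite fineK ?esum_fin.
Qed.

Lemma rsumZ T (D : set T) (c : R) (g : T -> R) : rsummable D g ->
  rsum D (fun x => c * g x) = c * rsum D g.
Proof.
wlog c0 : c / 0 <= c => [H gs|gs].
  have [c0|c0] := leP 0 c; first exact: H.
  rewrite -[in RHS](opprK c) mulNr -H ?oppr_ge0 ?ltW// -rsumN.
  by apply: eq_rsum => x Dx; rewrite mulNr opprK.
rewrite (@rsumE _ _ (fun x => c * Num.max (g x) 0)
  (fun x => c * Num.max (- g x) 0)).
- rewrite (fineZ c0 (fun x _ => max0 (g x)) (rsummable_pos gs)).
  rewrite (fineZ c0 (fun x _ => max0 (- g x)) (rsummable_neg gs)).
  by rewrite -mulrBr.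
- by move=> x _; rewrite mulr_ge0.
- by move=> x _; rewrite mulr_ge0.
- by apply: esum_ltZ => //; exact: rsummable_pos.
- by apply: esum_ltZ => //; exact: rsummable_neg.
- by move=> x _; rewrite -mulrBr -maxE.
Qed.

Lemma le_rsum T (D : set T) (g h : T -> R) :
  (forall x, D x -> `|g x| <= h x) -> (\esum_(x in D) (h x)%:E < +oo)%E ->
  rsum D g <= fine (\esum_(x in D) (h x)%:E).
Proof.
move=> gh hoo.
have h0 x : D x -> 0 <= h x by move=> Dx; rewrite (le_trans _ (gh _ Dx)).
have gs : rsummable D g.
  by apply: le_lt_trans hoo; apply: le_esum => x Dx; rewrite lee_fin gh.
rewrite /rsum lerBlDr (@le_trans _ _ (fine (\esum_(x in D) (h x)%:E)))//.
  rewrite fine_le ?esum_fin//; first exact: rsummable_pos.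
  apply: le_esum => x Dx; rewrite lee_fin ge_max h0// andbT.
  by rewrite (le_trans (ler_norm _))// gh.
by rewrite lerDl fine_ge0// esum_ge0// => x Dx; rewrite lee_fin.
Qed.

Lemma reindex_rsum T1 T2 (P : set T1) (Q : set T2) (e : T1 -> T2) (g : T2 -> R) :
  set_bij P Q e -> rsum Q g = rsum P (fun x => g (e x)).
Proof. by move=> bije; rewrite /rsum !(reindex_esum P Q e). Qed.

Lemma rsum_set1P T (D : set T) (g : T -> R) x : D x ->
  (forall y, D y -> y != x -> g y = 0) -> rsum D g = g x.
Proof.
move=> Dx g0; rewrite [RHS]maxE /rsum; congr (_ - _).
  rewrite (esumID [set x]) => [|y _]; last by rewrite lee_fin.
  rewrite setI1 mem_set// esum_set1 ?lee_fin// esum1 ?adde0// => y [Dy].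
  by move=> /eqP yx; rewrite g0// maxxx.
rewrite (esumID [set x]) => [|y _]; last by rewrite lee_fin.
rewrite setI1 mem_set// esum_set1 ?lee_fin// esum1 ?adde0// => y [Dy].
by move=> /eqP yx; rewrite g0// oppr0 maxxx.
Qed.

Lemma rsum_rsum T1 T2 (I : set T1) (J : T1 -> set T2) (g : T1 -> T2 -> R) :
  rsummable (I `*`` J) (fun k => g k.1 k.2) ->
  rsum I (fun i => rsum (J i) (g i)) = rsum (I `*`` J) (fun k => g k.1 k.2).
Proof.
move=> gs.
have P0 (h : T1 -> T2 -> R) i : (0 <= \esum_(j in J i) (Num.max (h i j) 0)%:E)%E.
  by apply: esum_ge0 => j _; rewrite lee_fin.
have F (h : T1 -> T2 -> R) : rsummable (I `*`` J) (fun k => h k.1 k.2) ->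
    (forall i, I i -> \esum_(j in J i) (Num.max (h i j) 0)%:E \is a fin_num) /\
    (\esum_(i in I) \esum_(j in J i) (Num.max (h i j) 0)%:E =
      \esum_(k in I `*`` J) (Num.max (h k.1 k.2) 0)%:E)%E.
  move=> hs; have E : (\esum_(i in I) \esum_(j in J i) (Num.max (h i j) 0)%:E =
      \esum_(k in I `*`` J) (Num.max (h k.1 k.2) 0)%:E)%E.
    by rewrite (@esum_esum _ _ _ I J (fun i j => (Num.max (h i j) 0)%:E))//
      => i j _ _; rewrite lee_fin.
  split=> // i Ii; rewrite ge0_fin_numE//.
  have : (\esum_(i in I) \esum_(j in J i) (Num.max (h i j) 0)%:E < +oo)%E.
    by rewrite E; exact: rsummable_pos hs.
  apply: le_lt_trans; apply: esum_ge; exists [set i].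
    by split => // _ ->.
  by rewrite fsbig_set1.
have gNs : rsummable (I `*`` J) (fun k => - g k.1 k.2).
  by apply: le_lt_trans gs; apply: le_esum => x _; rewrite normrN.
have [gfin gE] := F g gs; have [hfin hE] := F (fun i j => - g i j) gNs.
rewrite (@rsumE _ _ (fun i => fine (\esum_(j in J i) (Num.max (g i j) 0)%:E))
  (fun i => fine (\esum_(j in J i) (Num.max (- g i j) 0)%:E))) //.
- rewrite [in RHS]/rsum -gE -hE.
  by congr (fine _ - fine _); apply: eq_esum => i Ii; rewrite fineK// ?gfin// ?hfin.
- by move=> i Ii; rewrite fine_ge0.
- by move=> i Ii; rewrite fine_ge0// (P0 (fun i j => - g i j)).
- rewrite (eq_esum (b := fun i => \esum_(j in J i) (Num.max (g i j) 0)%:E)%E).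
    by rewrite gE; exact: rsummable_pos gs.
  by move=> i Ii; rewrite fineK// gfin.
- rewrite (eq_esum (b := fun i => \esum_(j in J i) (Num.max (- g i j) 0)%:E)%E).
    by rewrite hE; exact: rsummable_neg gs.
  by move=> i Ii; rewrite fineK// hfin.
Qed.

End rsum.

Section csum.
Context {R : realType}.
Implicit Types T : choiceType.

Definition csummable T (D : set T) (f : T -> R[i]) :=
  (\esum_(x in D) (normc (f x))%:E < +oo)%E.

Lemma ler_Re_normc (z : R[i]) : `|complex.Re z| <= normc z.
Proof.
case: z => x y /=; rewrite -sqrtr_sqr ler_wsqrtr// lerDl.
exact: sqr_ge0.
Qed.

Lemma ler_Im_normc (z : R[i]) : `|complex.Im z| <= normc z.
Proof.
case: z => x y /=; rewrite -sqrtr_sqr ler_wsqrtr// lerDr.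
exact: sqr_ge0.
Qed.

Lemma normc_rotate (z : R[i]) : z != 0 ->
  exists2 u : R[i], normc u = 1 & normc z = complex.Re (u * z).
Proof.
case: z => x y z0; have nz0 : normc (x +i* y) != 0.
  by apply: contra z0 => /eqP/eq0_normc ->.
have : x ^+ 2 + y ^+ 2 = normc (x +i* y) ^+ 2.
  by rewrite /= sqr_sqrtr// addr_ge0// sqr_ge0.
move: (normc _) nz0 => r r0 xyr.
have E : x / r * x - - (y / r) * y = r.
  by apply: (mulfI r0); rewrite -expr2 -xyr; field.
exists ((x / r) -i* (y / r)); last exact/esym.
rewrite /= sqrrN !expr_div_n -mulrDl xyr divff ?sqrtr1//.
by rewrite sqrf_eq0.
Qed.

Lemma csummable_Re T (D : set T) f : csummable D f ->
  rsummable D (fun x => complex.Re (f x)).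
Proof.
by apply: le_lt_trans; apply: le_esum => x Dx; rewrite lee_fin ler_Re_normc.
Qed.

Lemma csummable_Im T (D : set T) f : csummable D f ->
  rsummable D (fun x => complex.Im (f x)).
Proof.
by apply: le_lt_trans; apply: le_esum => x Dx; rewrite lee_fin ler_Im_normc.
Qed.

Lemma csummableZ T (D : set T) c f : csummable D f ->
  csummable D (fun x => c * f x).
Proof.
move=> fs; rewrite /csummable.
under eq_esum do rewrite normcM.
by apply: esum_ltZ => // *; exact: normc_ge0.
Qed.

Lemma eq_csum T (D : set T) (f g : T -> R[i]) :
  (forall x, D x -> f x = g x) -> csum D f = csum D g.
Proof.
by move=> fg; rewrite /csum; congr (_ +i* _); apply: eq_rsum => x Dx; rewrite fg.
Qed.

Lemma csumD T (D : set T) (f g : T -> R[i]) : csummable D f -> csummable D g ->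
  csum D (fun x => f x + g x) = csum D f + csum D g.
Proof.
move=> fs gs; rewrite /csum.
rewrite -[RHS]/((_ + _) +i* (_ + _)) 
  -(rsumD (csummable_Re fs) (csummable_Re gs))
  -(rsumD (csummable_Im fs) (csummable_Im gs)).
by congr (_ +i* _); apply: eq_rsum => x _; case: (f x); case: (g x).
Qed.

Lemma csumZl T (D : set T) (c : R[i]) (f : T -> R[i]) : csummable D f ->
  csum D (fun x => c * f x) = c * csum D f.
Proof.
move=> fs; case: c => a b.
have res := csummable_Re fs; have ims := csummable_Im fs.
have Zs (k : R) g : rsummable D g -> rsummable D (fun x => k * g x).
  rewrite /rsummable => gs; under eq_esum do rewrite normrM.
  exact: esum_ltZ.
rewrite /csum -[RHS]/((_ - _) +i* (_ + _)).
congr (_ +i* _).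
  rewrite -!rsumZ// -rsumN -rsumD; last 2 first.
  - exact: Zs.
  - rewrite /rsummable; under eq_esum do rewrite normrN; exact: Zs.
  by apply: eq_rsum => x _; case: (f x).
rewrite -!rsumZ// -rsumD; [|exact: Zs|exact: Zs].
by apply: eq_rsum => x _; case: (f x).
Qed.

Lemma csumZr T (D : set T) (c : R[i]) (f : T -> R[i]) : csummable D f ->
  csum D (fun x => f x * c) = csum D f * c.
Proof.
by move=> fs; rewrite mulrC -csumZl//; apply: eq_csum => x _; rewrite mulrC.
Qed.

Lemma reindex_csum T1 T2 (P : set T1) (Q : set T2) (e : T1 -> T2)
    (f : T2 -> R[i]) :
  set_bij P Q e -> csum Q f = csum P (fun x => f (e x)).
Proof. by move=> bije; rewrite /csum !(reindex_rsum _ bije). Qed.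

Lemma csum_set1P T (D : set T) (f : T -> R[i]) x : D x ->
  (forall y, D y -> y != x -> f y = 0) -> csum D f = f x.
Proof.
move=> Dx f0; rewrite /csum !(@rsum_set1P _ _ D _ x)//; first by case: (f x).
- by move=> y Dy yx; rewrite f0.
- by move=> y Dy yx; rewrite f0.
Qed.

Lemma csum_csum T1 T2 (I : set T1) (J : T1 -> set T2) (f : T1 -> T2 -> R[i]) :
  csummable (I `*`` J) (fun k => f k.1 k.2) ->
  csum I (fun i => csum (J i) (f i)) = csum (I `*`` J) (fun k => f k.1 k.2).
Proof.
move=> fs; rewrite /csum; congr (_ +i* _).
  exact: rsum_rsum (csummable_Re fs).
exact: rsum_rsum (csummable_Im fs).
Qed.

Lemma normc_csum T (D : set T) (f : T -> R[i]) : csummable D f ->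
  normc (csum D f) <= fine (\esum_(x in D) (normc (f x))%:E).
Proof.
move=> fs; have [->|z0] := eqVneq (csum D f) 0.
  by rewrite normc0 fine_ge0// esum_ge0// => x Dx; rewrite lee_fin normc_ge0.
have [u nu ->] := normc_rotate z0.
rewrite -csumZl//= le_rsum// => x Dx.
by rewrite (le_trans (ler_Re_normc _))// normcM nu mul1r.
Qed.

End csum.

Record weight (R : realType) (S : monoidType) := Weight {
  weight_fun :> S -> R;
  weight_gt0 : forall s, 0 < weight_fun s;
  weightM : forall s t, weight_fun (s * t)%g <= weight_fun s * weight_fun t;
  weight1 : weight_fun 1%g = 1
}.

Section ell1.
Context {R : realType} {S : monoidType} (w : weight R S).
Implicit Types (f g h : S -> R[i]) (r s t : S).

Definition weighted_sum f : \bar R :=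
  (\esum_(s in [set: S]) (normc (f s) * w s)%:E)%E.

Definition ell1_pred : {pred S -> R[i]} := fun f => `[< (weighted_sum f < +oo)%E >].

Let w0 s : 0 <= w s. Proof. exact/ltW/weight_gt0. Qed.

Let nw0 f s : 0 <= normc (f s) * w s.
Proof. by rewrite mulr_ge0// normc_ge0. Qed.

Let weighted_sum_ge0 f : (0 <= weighted_sum f)%E.
Proof. by apply: esum_ge0 => s _; rewrite lee_fin nw0. Qed.

Let weighted_sum_fin f : (weighted_sum f < +oo)%E ->
  weighted_sum f = (fine (weighted_sum f))%:E.
Proof. by move=> foo; rewrite fineK// ge0_fin_numE// weighted_sum_ge0. Qed.

Let weighted_sumD f g :
  (weighted_sum (f + g)%R <= weighted_sum f + weighted_sum g)%E.
Proof.
rewrite /weighted_sum -esumD => [|s _|s _]; try by rewrite lee_fin nw0.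
apply: le_esum => s _; rewrite -EFinD lee_fin -mulrDl ler_wpM2r//.
exact: le_normcD.
Qed.

Let weighted_sumZ_lt (c : R[i]) f : (weighted_sum f < +oo)%E ->
  (weighted_sum (c *: f)%R <= (normc c * fine (weighted_sum f))%:E)%E.
Proof.
move=> foo; rewrite /weighted_sum.
rewrite (eq_esum (b := fun s => (normc c * (normc (f s) * w s))%:E)%E).
  by apply: le_esumZ; rewrite ?normc_ge0// -weighted_sum_fin.
by move=> s _; rewrite mulrA -normcM.
Qed.

Let weighted_sum0 : weighted_sum 0 = 0%E.
Proof. by rewrite /weighted_sum esum1// => s _; rewrite normc0 mul0r. Qed.

Let ell1_closed : GRing.subsemimod_closed ell1_pred.
Proof.
split; [split|].
- by apply/asboolP; rewrite weighted_sum0 ltry.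
- move=> f g /asboolP foo /asboolP goo; apply/asboolP.
  exact: le_lt_trans (weighted_sumD f g) (lte_add_pinfty foo goo).
- move=> c f /asboolP foo; apply/asboolP.
  exact: le_lt_trans (weighted_sumZ_lt c foo) (ltry _).
Qed.

Record ell1 := Ell1 { ell1_fun :> S -> R[i]; _ : ell1_pred ell1_fun }.

HB.instance Definition _ := [isSub for ell1_fun].
HB.instance Definition _ := [Choice of ell1 by <:].
HB.instance Definition _ :=
  GRing.SubChoice_isSubLmodule.Build R[i] (S -> R[i]) ell1_pred ell1 ell1_closed.

Definition ell1_norm (f : ell1) : R := fine (weighted_sum f).

Lemma ell1P (f : ell1) : (weighted_sum f < +oo)%E.
Proof. by case: f => f /= /asboolP. Qed.

Lemma ell1_normE (f : ell1) : weighted_sum f = (ell1_norm f)%:E.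
Proof. by rewrite /ell1_norm -weighted_sum_fin// ell1P. Qed.

Lemma ell1_norm_ge0 (f : ell1) : 0 <= ell1_norm f.
Proof. exact/fine_ge0/weighted_sum_ge0. Qed.

Lemma ell1_ext (f g : ell1) : (forall s, f s = g s) -> f = g.
Proof. by move=> fg; apply/val_inj/funext. Qed.

Lemma ler_ell1_norm (f : ell1) s : normc (f s) * w s <= ell1_norm f.
Proof.
rewrite -lee_fin -ell1_normE; apply: esum_ge; exists [set s].
  by split.
by rewrite fsbig_set1.
Qed.

Lemma ell1_norm_eq0 (f : ell1) : ell1_norm f = 0 -> f = 0.
Proof.
move=> f0; apply: ell1_ext => s; apply: eq0_normc; apply/eqP.
have := ler_ell1_norm f s; rewrite f0 pmulr_lle0 ?weight_gt0// => fs0.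
by rewrite eq_le fs0 normc_ge0.
Qed.

Lemma ell1_normD (f g : ell1) : ell1_norm (f + g) <= ell1_norm f + ell1_norm g.
Proof. by rewrite -lee_fin EFinD -!ell1_normE; exact: weighted_sumD. Qed.

Let ell1_normZ_le (c : R[i]) (f : ell1) :
  ell1_norm (c *: f) <= normc c * ell1_norm f.
Proof. by rewrite -lee_fin -ell1_normE; exact: weighted_sumZ_lt (ell1P f). Qed.

Lemma ell1_normZ (c : R[i]) (f : ell1) :
  ell1_norm (c *: f) = normc c * ell1_norm f.
Proof.
apply/eqP; rewrite eq_le ell1_normZ_le/=.
have [->|c0] := eqVneq c 0.
  by rewrite scale0r normc0 mul0r ell1_norm_ge0.
have nc0 : normc c != 0 by apply: contra c0 => /eqP/eq0_normc ->.
have nc_gt0 : 0 < normc c by rewrite lt_neqAle eq_sym nc0 normc_ge0.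
rewrite -ler_pdivlMl// -normcV -{1}(scale1r f) -(mulVf c0) -scalerA.
exact: ell1_normZ_le.
Qed.

Definition conv_dom r : set (S * S) := [set st | (st.1 * st.2)%g = r].

Definition conv f g : S -> R[i] :=
  fun r => csum (conv_dom r) (fun st => f st.1 * g st.2).

Let nfg_ge0 f g (st : S * S) :
  0 <= (normc (f st.1) * w st.1) * (normc (g st.2) * w st.2).
Proof. by rewrite mulr_ge0. Qed.

Let prod_bound f g : (weighted_sum f < +oo)%E -> (weighted_sum g < +oo)%E ->
  (\esum_(st in [set: S * S])
     ((normc (f st.1) * w st.1) * (normc (g st.2) * w st.2))%:E <=
   (fine (weighted_sum f) * fine (weighted_sum g))%:E)%E.
Proof.
move=> foo goo.
by apply: (esum_prod_le (nw0 f) (nw0 g)); rewrite -weighted_sum_fin.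
Qed.

Let prod_lt f g : (weighted_sum f < +oo)%E -> (weighted_sum g < +oo)%E ->
  (\esum_(st in [set: S * S])
     ((normc (f st.1) * w st.1) * (normc (g st.2) * w st.2))%:E < +oo)%E.
Proof. by move=> foo goo; apply: le_lt_trans (prod_bound foo goo) (ltry _). Qed.

Let le_esum_sub (T : choiceType) (D : set T) (a b : T -> R) :
  (forall x, D x -> a x <= b x) -> (forall x, 0 <= b x) ->
  (\esum_(x in D) (a x)%:E <= \esum_(x in [set: T]) (b x)%:E)%E.
Proof.
move=> ab b0; rewrite esum_mkcond; apply: le_esum => x _.
by case: ifPn => [/set_mem Dx|_]; rewrite lee_fin// ab.
Qed.

Let conv_summand f g r (st : S * S) : conv_dom r st ->
  normc (f st.1 * g st.2) <=
  (w r)^-1 * ((normc (f st.1) * w st.1) * (normc (g st.2) * w st.2)).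
Proof.
move=> <-; rewrite ler_pdivlMl ?weight_gt0// normcM mulrACA mulrC.
by rewrite ler_wpM2l ?mulr_ge0 ?normc_ge0// weightM.
Qed.

Lemma conv_summable f g r : (weighted_sum f < +oo)%E ->
  (weighted_sum g < +oo)%E ->
  csummable (conv_dom r) (fun st => f st.1 * g st.2).
Proof.
move=> foo goo; apply: le_lt_trans (le_esum_sub _ _) _.
- by move=> st; exact: conv_summand.
- by move=> st; rewrite mulr_ge0// invr_ge0.
- by apply: esum_ltZ => //; [rewrite invr_ge0|exact: prod_lt].
Qed.

Let conv_pointwise f g r : (weighted_sum f < +oo)%E -> (weighted_sum g < +oo)%E ->
  ((normc (conv f g r) * w r)%:E <= \esum_(st in conv_dom r)
     ((normc (f st.1) * w st.1) * (normc (g st.2) * w st.2))%:E)%E.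
Proof.
move=> foo goo; set X := esum _ _.
have Xoo : (X < +oo)%E.
  by apply: le_lt_trans (prod_lt foo goo); apply: le_esum_sub.
have Xfin : X \is a fin_num by apply: esum_fin Xoo => st _.
rewrite -(fineK Xfin) lee_fin -ler_pdivlMr ?weight_gt0// [leRHS]mulrC.
rewrite (le_trans (normc_csum (conv_summable r foo goo)))//.
rewrite -lee_fin fineK; last first.
  apply: esum_fin => [st _|]; [exact: normc_ge0|exact: conv_summable].
apply: le_trans (le_esumZ (a := fun st =>
    (normc (f st.1) * w st.1) * (normc (g st.2) * w st.2)) _ _) => //.
- by apply: le_esum => st Dst; rewrite lee_fin conv_summand.
- by rewrite invr_ge0.
- by rewrite fineK.
Qed.

Let conv_bound f g : (weighted_sum f < +oo)%E -> (weighted_sum g < +oo)%E ->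
  (weighted_sum (conv f g) <=
    (fine (weighted_sum f) * fine (weighted_sum g))%:E)%E.
Proof.
move=> foo goo; apply: le_trans (prod_bound foo goo).
apply: (@le_trans _ _ (\esum_(r in [set: S]) \esum_(st in conv_dom r)
     ((normc (f st.1) * w st.1) * (normc (g st.2) * w st.2))%:E)%E).
  by apply: le_esum => r _; exact: conv_pointwise.
rewrite (@esum_esum _ _ _ setT conv_dom (fun _ st =>
  ((normc (f st.1) * w st.1) * (normc (g st.2) * w st.2))%:E)%E); last first.
  by move=> r st _ _; rewrite lee_fin.
rewrite (reindex_esum setT (setT `*`` conv_dom)
  (fun st => ((st.1 * st.2)%g, st)))//.
split.
- by move=> [s t].
- by move=> [s t] [s' t'] _ _ [_ -> ->].
- by move=> [r [s t]] [_ /= <-]; exists (s, t).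
Qed.

Let conv_ell1 (f g : ell1) : ell1_pred (conv f g).
Proof.
by apply/asboolP; apply: le_lt_trans (conv_bound (ell1P f) (ell1P g)) (ltry _).
Qed.

Definition ell1_mul (f g : ell1) : ell1 := Ell1 (conv_ell1 f g).

Definition delta s : S -> R[i] := fun t => if t == s then 1 else 0.

Let delta_ell1 s : ell1_pred (delta s).
Proof.
apply/asboolP; rewrite /weighted_sum (esumID [set s]) => [|t _]; last first.
  by rewrite lee_fin.
rewrite setTI esum_set1 ?lee_fin// [X in (_ + X)%E]esum1 ?adde0 ?ltry// => t.
by move=> [_ /eqP ts]; rewrite /delta (negbTE ts) normc0 mul0r.
Qed.

Definition ell1_delta s : ell1 := Ell1 (delta_ell1 s).

Lemma ell1_norm_delta s : ell1_norm (ell1_delta s) = w s.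
Proof.
rewrite /ell1_norm /weighted_sum (esumID [set s]) => [|t _]; last first.
  by rewrite lee_fin.
rewrite setTI esum_set1 ?lee_fin// [X in (_ + X)%E]esum1 ?adde0 => [|t].
  by rewrite /= /delta eqxx normc1 mul1r.
by move=> [_ /eqP ts]; rewrite /= /delta (negbTE ts) normc0 mul0r.
Qed.

Let conv_delta1l f : conv (delta 1%g) f = f.
Proof.
apply/funext => r; rewrite /conv (@csum_set1P _ _ _ _ (1%g, r)).
- by rewrite /= /delta eqxx mul1r.
- by rewrite /conv_dom /= mul1g.
- move=> [s t] str; rewrite /delta/=; case: (eqVneq _ 1%g) => [s1|]; last by rewrite mul0r.
  by move: str; rewrite /conv_dom/= s1 mul1g => ->; rewrite eqxx.
Qed.

Let conv_delta1r f : conv f (delta 1%g) = f.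
Proof.
apply/funext => r; rewrite /conv (@csum_set1P _ _ _ _ (r, 1%g)).
- by rewrite /= /delta eqxx mulr1.
- by rewrite /conv_dom /= mulg1.
- move=> [s t] str; rewrite /delta/=; case: (eqVneq _ 1%g) => [t1|]; last by rewrite mulr0.
  by move: str; rewrite /conv_dom/= t1 mulg1 => ->; rewrite eqxx.
Qed.

Let ell1_mul1l : left_id (ell1_delta 1%g) ell1_mul.
Proof. by move=> f; apply: val_inj; exact: conv_delta1l. Qed.

Let ell1_mul1r : right_id (ell1_delta 1%g) ell1_mul.
Proof. by move=> f; apply: val_inj; exact: conv_delta1r. Qed.

Let ell1_mulDl : left_distributive ell1_mul +%R.
Proof.
move=> f g h; apply: ell1_ext => r.
rewrite -[RHS]/(conv f h r + conv g h r) /conv -csumD.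
- by apply: eq_csum => -[s t] _; rewrite mulrDl.
- by apply: conv_summable; exact: ell1P.
- by apply: conv_summable; exact: ell1P.
Qed.

Let ell1_mulDr : right_distributive ell1_mul +%R.
Proof.
move=> f g h; apply: ell1_ext => r.
rewrite -[RHS]/(conv f g r + conv f h r) /conv -csumD.
- by apply: eq_csum => -[s t] _; rewrite mulrDr.
- by apply: conv_summable; exact: ell1P.
- by apply: conv_summable; exact: ell1P.
Qed.

Let ell1_scaleAl (k : R[i]) (f g : ell1) :
  k *: ell1_mul f g = ell1_mul (k *: f) g.
Proof.
apply: ell1_ext => r; rewrite -[LHS]/(k * conv f g r) /conv -csumZl.
  by apply: eq_csum => -[s t] _; rewrite mulrA.
by apply: conv_summable; exact: ell1P.
Qed.

Let ell1_scaleAr (k : R[i]) (f g : ell1) :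
  k *: ell1_mul f g = ell1_mul f (k *: g).
Proof.
apply: ell1_ext => r; rewrite -[LHS]/(k * conv f g r) /conv -csumZl.
  by apply: eq_csum => -[s t] _; rewrite mulrCA.
by apply: conv_summable; exact: ell1P.
Qed.

Let triple r : set (S * (S * S)) :=
  [set k | (k.1 * (k.2.1 * k.2.2))%g = r].

Let triple_summable (f g h : ell1) r :
  csummable (triple r) (fun k => f k.1 * g k.2.1 * h k.2.2).
Proof.
pose b (k : S * S) := (normc (g k.1) * w k.1) * (normc (h k.2) * w k.2).
have b0 k : 0 <= b k by rewrite mulr_ge0.
have wV : 0 <= (w r)^-1 by rewrite invr_ge0.
pose a (k : S * (S * S)) := (w r)^-1 * ((normc (f k.1) * w k.1) * b k.2).
have a0 k : 0 <= a k by rewrite mulr_ge0// mulr_ge0.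
apply: le_lt_trans (le_esum_sub (b := a) _ a0) _.
  move=> [s [t u]]; rewrite /triple /= => strE; rewrite /a /b /= -strE ler_pdivlMl ?weight_gt0// !normcM.
  have wstu : w (s * (t * u))%g <= w s * (w t * w u).
    by rewrite (le_trans (weightM _ _ _))// ler_wpM2l// weightM.
  apply: (@le_trans _ _ (normc (f s) * normc (g t) * normc (h u) *
    (w s * (w t * w u)))); last by rewrite le_eqVlt; apply/orP; left; apply/eqP; ring.
  by rewrite mulrC ler_wpM2l// !mulr_ge0// normc_ge0.
have fM : (\esum_(s in [set: S]) (normc (f s) * w s)%:E <= (ell1_norm f)%:E)%E.
  by rewrite -ell1_normE.
have ghM := prod_bound (ell1P g) (ell1P h).
by apply: (le_lt_trans (le_esumZ wV (esum_prod_le (nw0 f) b0 fM ghM))); exact: ltry.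
Qed.

Let fiberl r : set ((S * S) * (S * S)) :=
  conv_dom r `*`` (fun st => conv_dom st.1).

Let fiberr r : set ((S * S) * (S * S)) :=
  conv_dom r `*`` (fun st => conv_dom st.2).

Let triple_fiberl r : set_bij (triple r) (fiberl r)
  (fun k => (((k.1 * k.2.1)%g, k.2.2), (k.1, k.2.1))).
Proof.
split.
- by move=> [s [t u]] /= str; split=> //=; rewrite /conv_dom/= -mulgA.
- by move=> [s [t u]] [s' [t' u']] _ _ /= [_ -> -> ->].
- move=> [[x u] [s t]] [/= xr stx]; exists (s, (t, u)).
    by move: xr stx; rewrite /triple /conv_dom /= => <- <-; rewrite mulgA.
  by move: stx; rewrite /conv_dom /= => ->.
Qed.

Let triple_fiberr r : set_bij (triple r) (fiberr r)
  (fun k => ((k.1, (k.2.1 * k.2.2)%g), k.2)).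
Proof.
split.
- by move=> [s [t u]] /= str; split.
- by move=> [s [t u]] [s' [t' u']] _ _ /= [-> _ -> ->].
- move=> [[s x] [t u]] [/= sxr tux]; exists (s, (t, u)).
    by move: sxr tux; rewrite /triple /conv_dom /= => <- <-.
  by move: tux; rewrite /conv_dom /= => ->.
Qed.

Let csummable_reindex (T1 T2 : choiceType) (P : set T1) (Q : set T2)
    (e : T1 -> T2) (F : T2 -> R[i]) : set_bij P Q e ->
  csummable P (fun x => F (e x)) -> csummable Q F.
Proof. by move=> ebij; rewrite /csummable (reindex_esum P Q e). Qed.

Let ell1_mulA : associative ell1_mul.
Proof.
move=> f g h; apply: ell1_ext => r.
transitivity (csum (triple r) (fun k => f k.1 * g k.2.1 * h k.2.2)).
  rewrite -[LHS]/(conv f (conv g h) r) /conv.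
  pose F (k : (S * S) * (S * S)) := f k.1.1 * g k.2.1 * h k.2.2.
  rewrite -(reindex_csum F (triple_fiberr r)).
  rewrite -(@csum_csum _ _ _ _ _ (fun x y => F (x, y))); last first.
    by apply: csummable_reindex (triple_fiberr r) _; exact: triple_summable.
  apply: eq_csum => -[s x] _ /=; rewrite -csumZl.
    by apply: eq_csum => -[t u] _; rewrite /F /= mulrA.
  by apply: conv_summable; exact: ell1P.
rewrite -[RHS]/(conv (conv f g) h r) /conv.
pose F (k : (S * S) * (S * S)) := f k.2.1 * g k.2.2 * h k.1.2.
rewrite -(reindex_csum F (triple_fiberl r)).
rewrite -(@csum_csum _ _ _ _ _ (fun x y => F (x, y))); last first.
  by apply: csummable_reindex (triple_fiberl r) _; exact: triple_summable.
apply: eq_csum => -[x u] _ /=; rewrite -csumZr//.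
by apply: conv_summable; exact: ell1P.
Qed.

Let ell1_delta1_neq0 : ell1_delta 1%g != 0.
Proof.
apply/eqP => /(congr1 (fun f : ell1 => f 1%g)) /= /eqP.
by rewrite /delta eqxx oner_eq0.
Qed.

HB.instance Definition _ := GRing.Zmodule_isNzRing.Build ell1
  ell1_mulA ell1_mul1l ell1_mul1r ell1_mulDl ell1_mulDr ell1_delta1_neq0.

HB.instance Definition _ :=
  GRing.Lmodule_isLalgebra.Build R[i] ell1 ell1_scaleAl.

HB.instance Definition _ :=
  GRing.Lalgebra_isAlgebra.Build R[i] ell1 ell1_scaleAr.

Lemma ell1_mulE (f g : ell1) r :
  (f * g) r = csum [set st | (st.1 * st.2)%g = r] (fun st => f st.1 * g st.2).
Proof. by []. Qed.

Lemma ell1_1E : (1 : ell1) = ell1_delta 1%g.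
Proof. by []. Qed.

Lemma ell1_normM (f g : ell1) : ell1_norm (f * g) <= ell1_norm f * ell1_norm g.
Proof. by rewrite -lee_fin -ell1_normE; exact: conv_bound (ell1P f) (ell1P g). Qed.

Lemma ell1_norm1 : ell1_norm 1 = 1.
Proof. by rewrite ell1_1E ell1_norm_delta weight1. Qed.

Let real_cauchy_cvg (x : nat -> R) :
  (forall e : R, 0 < e -> exists N, forall m n, (N <= m)%N -> (N <= n)%N ->
     `|x m - x n| < e) -> cvg (x @ \oo).
Proof.
move=> xC; apply/cauchy_cvgP/cauchy_exP => e e0; have [N xN] := xC _ e0.
by exists (x N), N => // n /= Nn; exact: xN.
Qed.

Lemma ell1_complete (u : nat -> ell1) :
  (forall e : R, 0 < e -> exists N, forall m n, (N <= m)%N -> (N <= n)%N ->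
     ell1_norm (u m - u n) < e) ->
  exists l, ell1_norm (u n - l) @[n --> \oo] --> (0 : R).
Proof.
move=> uC.
have pt (s : S) (e : R) : 0 < e -> exists N, forall m n, (N <= m)%N -> (N <= n)%N ->
    normc (u m s - u n s) < e.
  move=> e0; have [N uN] := uC (e * w s) (mulr_gt0 e0 (weight_gt0 w s)).
  exists N => m n Nm Nn; rewrite -(ltr_pM2r (weight_gt0 w s)).
  exact: le_lt_trans (ler_ell1_norm (u m - u n) s) (uN _ _ Nm Nn).
have ReB (a b : R[i]) : complex.Re a - complex.Re b = complex.Re (a - b).
  by case: a; case: b.
have ImB (a b : R[i]) : complex.Im a - complex.Im b = complex.Im (a - b).
  by case: a; case: b.
have cRe s : cvg (complex.Re (u n s) @[n --> \oo]).
  apply: real_cauchy_cvg => e /(pt s)[N uN]; exists N => m n Nm Nn.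
  by rewrite ReB; exact: le_lt_trans (ler_Re_normc _) (uN _ _ Nm Nn).
have cIm s : cvg (complex.Im (u n s) @[n --> \oo]).
  apply: real_cauchy_cvg => e /(pt s)[N uN]; exists N => m n Nm Nn.
  by rewrite ImB; exact: le_lt_trans (ler_Im_normc _) (uN _ _ Nm Nn).
pose l s : R[i] := lim (complex.Re (u n s) @[n --> \oo]) +i*
                   lim (complex.Im (u n s) @[n --> \oo]).
have normc_cvg m s :
    normc (u m s - u n s) @[n --> \oo] --> normc (u m s - l s).
  have normcE (z : R[i]) :
      normc z = Num.sqrt (complex.Re z ^+ 2 + complex.Im z ^+ 2) by case: z.
  rewrite normcE (_ : (fun n => _) = fun n => Num.sqrt (
    (complex.Re (u m s) - complex.Re (u n s)) ^+ 2 +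
    (complex.Im (u m s) - complex.Im (u n s)) ^+ 2)); last first.
    by apply/funext => n; rewrite normcE -ReB -ImB.
  apply: continuous_cvg; first exact: sqrt_continuous.
  by rewrite -ReB -ImB; apply: cvgD; apply: cvgM; apply: cvgB => //;
    exact: cvg_cst.
have tail (e : R) : 0 < e -> exists N, forall m, (N <= m)%N ->
    (weighted_sum (fun s => u m s - l s)%R <= e%:E)%E.
  move=> /uC[N uN]; exists N => m Nm; apply: esum_le_bound => X finX _.
  rewrite fsbig_finite//=.
  apply: (@cvgr_to_le nat \oo _ R (fun n =>
    \sum_(s <- fset_set X) normc (u m s - u n s) * w s)).
    apply: cvg_big => [|s _]; first exact: add_continuous.
    by apply: cvgM; [exact: normc_cvg|exact: cvg_cst].
  exists N => // n /= Nn; rewrite -(fsbig_finite _ _ finX)/=.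
  apply: le_trans (ltW (uN _ _ Nm Nn)).
  by apply: (esum_bound (D := setT)) => //; rewrite -ell1_normE.
have lP : ell1_pred l.
  have [N lN] := tail _ ltr01.
  have dP : ell1_pred (fun s => u N s - l s).
    by apply/asboolP; apply: le_lt_trans (lN _ (leqnn N)) (ltry _).
  apply/asboolP; rewrite (_ : l = ((u N : ell1) - Ell1 dP : ell1)).
    exact: ell1P.
  apply/funext => s; rewrite -[RHS]/(u N s - (u N s - l s)).
  by rewrite opprB addrC subrK.
exists (Ell1 lP); apply/cvgrPdist_le => e /tail[N uN]; exists N => // n /= Nn.
rewrite sub0r normrN ger0_norm ?ell1_norm_ge0//.
by rewrite -lee_fin -ell1_normE; exact: uN.
Qed.

Definition ell1_banach : unitalBanachAlg R :=
  UnitalBanachAlg ell1_norm_eq0 ell1_normD ell1_normZ ell1_normM ell1_norm1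
    ell1_complete.

End ell1.

Section bicyclic.

Definition gen_p : bool := true.
Definition gen_q : bool := false.

(* The least monoid congruence on the words over {p, q} such that pq ~ e. *)
Inductive bc_cong : seq bool -> seq bool -> Prop :=
| bc_cong_pq u v : bc_cong (u ++ [:: gen_p; gen_q] ++ v) (u ++ v)
| bc_cong_refl u : bc_cong u u
| bc_cong_sym u v : bc_cong u v -> bc_cong v u
| bc_cong_trans u v x : bc_cong u v -> bc_cong v x -> bc_cong u x.

Lemma bc_cong_cat u u' v v' :
  bc_cong u u' -> bc_cong v v' -> bc_cong (u ++ v) (u' ++ v').
Proof.
have catl x y y' : bc_cong y y' -> bc_cong (x ++ y) (x ++ y').
  elim=> [a b|a|a b _|a b c _ + _].
  - by rewrite !catA -(catA (x ++ a)); exact: bc_cong_pq.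
  - exact: bc_cong_refl.
  - exact: bc_cong_sym.
  - exact: bc_cong_trans.
have catr x y y' : bc_cong y y' -> bc_cong (y ++ x) (y' ++ x).
  elim=> [a b|a|a b _|a b c _ + _].
  - by rewrite -!catA; exact: bc_cong_pq.
  - exact: bc_cong_refl.
  - exact: bc_cong_sym.
  - exact: bc_cong_trans.
by move=> /(catr v) uv /(catl u'); exact: bc_cong_trans.
Qed.

Definition bc_equiv : rel (seq bool) := fun u v => `[< bc_cong u v >].

Let bc_equiv_refl : reflexive bc_equiv.
Proof. by move=> u; apply/asboolP; exact: bc_cong_refl. Qed.
Let bc_equiv_sym : symmetric bc_equiv.
Proof. by move=> u v; apply/asboolP/asboolP; exact: bc_cong_sym. Qed.
Let bc_equiv_trans : transitive bc_equiv.
Proof.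
move=> v u x /asboolP uv /asboolP vx; apply/asboolP.
exact: bc_cong_trans uv vx.
Qed.

Canonical bc_equiv_equivRel :=
  EquivRel bc_equiv bc_equiv_refl bc_equiv_sym bc_equiv_trans.

(* The bicyclic monoid < p, q : pq = e >. *)
Definition BC := {eq_quot bc_equiv}.

HB.instance Definition _ := Choice.on BC.
HB.instance Definition _ := EqQuotient.on BC.

Implicit Types x y z : BC.

Definition bc_mul x y : BC := \pi_BC (repr x ++ repr y).
Definition bc_one : BC := \pi_BC [::].

Lemma pi_bcP u v : \pi_BC u = \pi_BC v <-> bc_cong u v.
Proof. by split=> [/eqmodP/asboolP|?]; last exact/eqmodP/asboolP. Qed.

Let pi_bc_mul u v : bc_mul (\pi_BC u) (\pi_BC v) = \pi_BC (u ++ v).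
Proof. by apply/pi_bcP; apply: bc_cong_cat; apply/pi_bcP; rewrite reprK. Qed.

Let bc_mulA : associative bc_mul.
Proof.
elim/quotW => u; elim/quotW => v; elim/quotW => x.
by rewrite (pi_bc_mul v x) (pi_bc_mul u v) !pi_bc_mul catA.
Qed.
Let bc_mul1l : left_id bc_one bc_mul.
Proof. by elim/quotW => u; rewrite pi_bc_mul. Qed.
Let bc_mul1r : right_id bc_one bc_mul.
Proof. by elim/quotW => u; rewrite pi_bc_mul cats0. Qed.

HB.instance Definition _ := isMonoid.Build BC bc_mulA bc_mul1l bc_mul1r.

Definition bc_p : BC := \pi_BC [:: gen_p].
Definition bc_q : BC := \pi_BC [:: gen_q].

Lemma pi_bcM u v : \pi_BC (u ++ v) = (\pi_BC u * \pi_BC v)%g.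
Proof. exact/esym/pi_bc_mul. Qed.

Lemma pi_bc1 : \pi_BC [::] = 1%g.
Proof. by []. Qed.

Lemma bc_pq : (bc_p * bc_q)%g = 1%g.
Proof. by rewrite -pi_bcM -pi_bc1; apply/pi_bcP; exact: (bc_cong_pq [::] [::]). Qed.

End bicyclic.

Section bicyclic_weight.
Context (R : realType) (n : nat) (n_gt0 : (0 < n)%N).

Definition bc_omega (s : BC) : R := if s == 1%g then 1 else n%:R.

Let bc_omega_gt0 s : 0 < bc_omega s.
Proof. by rewrite /bc_omega; case: ifP => _; rewrite ?ltr01 ?ltr0n. Qed.

Let bc_omegaM s t : bc_omega (s * t)%g <= bc_omega s * bc_omega t.
Proof.
have n1 : 1 <= n%:R :> R by rewrite ler1n.
have n0 : 0 <= n%:R :> R by rewrite ler0n.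
rewrite /bc_omega; have [->|s1] := eqVneq s 1%g; first by rewrite mul1g mul1r.
have [->|t1] := eqVneq t 1%g; first by rewrite mulg1 mulr1 (negbTE s1).
by case: ifP => _; [rewrite mulr_ege1|rewrite ler_peMl].
Qed.

Let bc_omega1 : bc_omega 1%g = 1.
Proof. by rewrite /bc_omega eqxx. Qed.

Definition bc_weight : weight R BC := Weight bc_omega_gt0 bc_omegaM bc_omega1.

Definition bc_algebra : unitalBanachAlg R := ell1_banach bc_weight.

End bicyclic_weight.

(* Sequences are indexed from 0: term n is the algebra for the weight n + 1, so
   that the weights range over the integers n >= 1. *)
Definition bc_algebra_seq (R : realType) (n : nat) : unitalBanachAlg R :=
  bc_algebra R (ltn0Sn n).

(* Main.v *)
Require Import Defs.
From mathcomp Require Import all_boot all_order all_algebra.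
From mathcomp Require Import all_reals.
From mathcomp Require Import all_classical topology normedtype sequences.
From mathcomp Require Import esum complex.
Import Order.TTheory GRing.Theory Num.Theory.
Import numFieldNormedType.Exports.
Import ComplexField.Normc.
Local Open Scope classical_set_scope.
Local Open Scope ring_scope.

(** Elements [f], [g] of the algebra for the weight [n] that vanish at the unit
    have unweighted l^1 norms [||f|| / n] and [||g|| / n], and the weight is at
    most [n], so [||f * g|| <= ||f|| ||g|| / n]. As scalars are central, every
    commutator satisfies [||f g - g f|| <= (8 / n) ||f|| ||g||]; hence the
    asymptotic sequence algebra is commutative, and so Dedekind-finite. Each
    term is Dedekind-infinite because [qp <> e], as seen in the action of the
    bicyclic monoid on the natural numbers by the successor and the
    predecessor. *)

(** The rightmost letter acts first, [p] as predecessor and [q] as successor: [pq] acts trivially,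
    while [qp] sends 0 to 1 because [0.-1 = 0]. *)
Fixpoint word_act (u : seq bool) (k : nat) : nat :=
  if u is b :: u' then
    if b == gen_p then (word_act u' k).-1 else (word_act u' k).+1
  else k.

Lemma word_act_cat (u v : seq bool) (k : nat) :
  word_act (u ++ v) k = word_act u (word_act v k).
Proof. by elim: u => //= b u ->. Qed.

Lemma bc_cong_act (u v : seq bool) : bc_cong u v -> word_act u =1 word_act v.
Proof.
elim=> [a b|a|a b _ ab|a b c _ ab _ bc] k //.
- by rewrite !word_act_cat.
- by rewrite ab bc.
Qed.

Lemma bc_qp_neq1 : (bc_q * bc_p)%g <> 1%g.
Proof.
by rewrite -pi_bcM -pi_bc1 => /pi_bcP/bc_cong_act/(_ 0%N).
Qed.

(** Scalars are central, so their contributions cancel; this allows both entries of a commutator to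
    be replaced by elements vanishing at the unit. *)
Lemma commutator_subl (K : pzRingType) (A : algType K) (x y : A) (k : K) :
  (x - k%:A) * y - y * (x - k%:A) = x * y - y * x.
Proof.
by rewrite mulrBl mulrBr mulr_algl mulr_algr opprB addrA subrK.
Qed.

Arguments commutator_subl {K A}.

Section ell1_extra.
Context {R : realType} {S : monoidType}.

Lemma csum0 (T : choiceType) (D : set T) (f : T -> R[i]) :
  (forall x, D x -> f x = 0) -> csum D f = 0.
Proof.
move=> f0; rewrite (eq_csum (g := fun=> 0 * 0)) => [|x /f0 ->].
  by rewrite csumZl ?mul0r// /csummable esum1 ?ltry// => x _; rewrite normc0.
by rewrite mul0r.
Qed.

Lemma ell1_deltaM (w : weight R S) (s t : S) :
  ell1_delta w s * ell1_delta w t = ell1_delta w (s * t)%g.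
Proof.
apply: ell1_ext => r; rewrite ell1_mulE /= /delta.
have delta0 (x : S * S) : x != (s, t) ->
    (if x.1 == s then 1 else 0) * (if x.2 == t then 1 else 0) = 0 :> R[i].
  case: x => x y; rewrite xpair_eqE /=.
  by case: (x == s); case: (y == t); rewrite ?mul0r ?mulr0.
have [->|rst] := eqVneq r (s * t)%g.
  rewrite (@csum_set1P _ _ _ _ (s, t)) //= ?eqxx ?mulr1// => x _.
  exact: delta0.
rewrite csum0// => x xr; apply: delta0.
by apply: contra rst => /eqP xst; rewrite -xr xst.
Qed.

(** Only the support of [f] contributes to the sum. Taking [c] to be 1/n, then n, converts between
    the norm for the weight n and the unweighted one. *)
Lemma le_weighted_sum (w w' : weight R S) (c : R) (f : ell1 w') : 0 <= c ->
  (forall s, f s != 0 -> w s <= c * w' s) ->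
  (weighted_sum w f <= (c * ell1_norm f)%:E)%E.
Proof.
move=> c0 ww'.
apply: (@le_trans _ _
    (\esum_(s in [set: S]) (c * (normc (f s) * w' s))%:E)%E).
  apply: le_esum => s _; rewrite lee_fin mulrCA.
  have [->|/ww' le_w] := eqVneq (f s) 0; first by rewrite normc0 !mul0r.
  by rewrite ler_wpM2l// normc_ge0.
by apply: le_esumZ => //; rewrite -ell1_normE.
Qed.

End ell1_extra.

Section bicyclic_commutator.
Context {R : realType} {n : nat} (n_gt0 : (0 < n)%N).
Local Notation A := (bc_algebra R n_gt0).

Let w1 := bc_weight R (ltn0Sn 0).

Let w1E s : w1 s = 1.
Proof. by rewrite /= /bc_omega; case: ifP. Qed.

Let n0 : 0 < n%:R :> R. Proof. by rewrite ltr0n. Qed.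

Let unweighted (f : A) : f 1%g = 0 ->
  exists2 g : ell1 w1, g = f :> (BC -> R[i]) & ell1_norm g <= n%:R^-1 * ba_norm f.
Proof.
move=> f1.
have le_f : (weighted_sum w1 f <= (n%:R^-1 * ba_norm f)%:E)%E.
  apply: le_weighted_sum => [|s fs]; first by rewrite invr_ge0 ltW.
  rewrite w1E /= /bc_omega; case: (s =P 1%g) fs => [->|_ _]; first by rewrite f1 eqxx.
  by rewrite mulVf// gt_eqF.
have f_w1 : ell1_pred w1 f by apply/asboolP; exact: le_lt_trans le_f (ltry _).
by exists (Ell1 f_w1) => //; rewrite -lee_fin -ell1_normE.
Qed.

Lemma bc_norm_augM (f g : A) : f 1%g = 0 -> g 1%g = 0 ->
  ba_norm (f * g) <= n%:R^-1 * (ba_norm f * ba_norm g).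
Proof.
move=> /unweighted[f' f'E f'le] /unweighted[g' g'E g'le].
(* Convolution does not involve the weight, so both products are the same function. *)
have fgE : f' * g' = f * g :> (BC -> R[i]).
  by apply/funext => r; rewrite !ell1_mulE f'E g'E.
have : ba_norm (f * g) <= n%:R * ell1_norm (f' * g').
  rewrite -lee_fin -ell1_normE -fgE; apply: le_weighted_sum => [|s _].
    exact: ltW.
  by rewrite w1E mulr1 /= /bc_omega; case: ifP => // _; rewrite ler1n.
move=> /le_trans; apply; rewrite -ler_pdivlMl//.
apply: le_trans (ell1_normM _ _) _.
rewrite [leRHS]mulrA [leRHS]mulrACA.
by apply: ler_pM => //; exact: ell1_norm_ge0.
Qed.

Let aug (f : A) : A := f - f 1%g *: 1.

Let aug1 f : aug f 1%g = 0.
Proof.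
rewrite -[LHS]/(f 1%g - f 1%g * delta 1%g 1%g) /delta eqxx mulr1.
by rewrite subrr.
Qed.

Let norm_aug f : ba_norm (aug f) <= 2 * ba_norm f.
Proof.
rewrite (le_trans (ba_normD _ _))// ba_normN ba_normZ ba_norm1 mulr1.
rewrite mulr_natl mulr2n lerD2l.
(* The weight is 1 at the unit, so the norm bounds the value there. *)
by have := ler_ell1_norm f 1%g; rewrite weight1 mulr1.
Qed.

Lemma bc_norm_commutator (f g : A) :
  ba_norm (f * g - g * f) <= 8 * n%:R^-1 * (ba_norm f * ba_norm g).
Proof.
rewrite -(commutator_subl f g (f 1%g)) -opprB.
rewrite -(commutator_subl g _ (g 1%g)) opprB.
(* The factor 4 comes from [norm_aug] applied to both entries; the two products of the commutator
   double it to 8. *)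
have le_aug (x y : A) : ba_norm (aug x * aug y) <=
    4 * n%:R^-1 * (ba_norm x * ba_norm y).
  apply: le_trans (bc_norm_augM _ _ (aug1 x) (aug1 y)) _.
  rewrite [4 * _]mulrC -mulrA ler_wpM2l ?invr_ge0 ?ler0n//.
  rewrite (_ : 4 * _ = (2 * ba_norm x) * (2 * ba_norm y)).
    by apply: ler_pM; rewrite ?ba_norm_ge0.
  by rewrite mulrACA -natrM.
rewrite (le_trans (ba_normD _ _))// ba_normN.
rewrite (le_trans (lerD (le_aug _ _) (le_aug _ _)))//.
by rewrite [ba_norm g * _]mulrC -!mulrDl -natrD.
Qed.

End bicyclic_commutator.

Lemma asy_mulC (R : realType) (A : nat -> unitalBanachAlg R) (c : nat -> R) :
  c n @[n --> \oo] --> (0 : R) ->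
  (forall n (x y : A n),
    ba_norm (x * y - y * x) <= c n * (ba_norm x * ba_norm y)) ->
  commutative (@GRing.mul (Asy A)).
Proof.
move=> c_to0 commA; elim/quotW => a; elim/quotW => b.
rewrite -!pi_asyM; apply/pi_asy_eq/asboolP.
have bounded (x : linfty A) : exists M, forall n, ba_norm (x n) <= M.
  exact/asboolP/(valP x).
have [M aM] := bounded a; have [N bN] := bounded b.
(* The sign of [c n] is unknown, hence the absolute value in the majorant. *)
have cMN : `|c n| * (M * N) @[n --> \oo] --> (0 : R).
  by rewrite -(mul0r (M * N)) -(normr0 R); apply: cvgMl; exact: cvg_norm.
apply: (squeeze_cvgr _ (cvg_cst 0) cMN); apply: nearW => n.
rewrite ba_norm_ge0/= (le_trans (commA n (a n) (b n)))//.
apply: (@le_trans _ _ (`|c n| * (ba_norm (a n) * ba_norm (b n)))).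
  by rewrite ler_wpM2r ?ler_norm// mulr_ge0// ba_norm_ge0.
by rewrite ler_wpM2l// ler_pM// ba_norm_ge0.
Qed.

Theorem theorem3p7 (R : realType) :
  (forall (n : nat) (n_gt0 : (0 < n)%N),
     dedekind_infinite (bc_algebra R n_gt0)) /\
  dedekind_finite (Asy (bc_algebra_seq R)).
Proof.
split=> [n n_gt0 fin|p _ [a [b [-> one_ba]]]].
  pose w := bc_weight R n_gt0.
  have pq1 : ell1_delta w bc_p * ell1_delta w bc_q = 1.
    by rewrite ell1_deltaM bc_pq ell1_1E.
  (* Since [pq = e], the element at [qp] is an idempotent equivalent to 1; finiteness would make it
     1, which evaluation at the unit refutes. *)
  have /(congr1 (fun f : ell1 w => f 1%g)) :
      ell1_delta w bc_q * ell1_delta w bc_p = 1.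
    apply: fin; last by exists (ell1_delta w bc_q), (ell1_delta w bc_p).
    by rewrite /idempotent_elt mulrA -(mulrA _ _ (ell1_delta w bc_q)) pq1 mulr1.
  rewrite ell1_deltaM ell1_1E /= /delta eqxx eq_sym; case: eqP => [/bc_qp_neq1//|_].
  by move=> /esym/eqP; rewrite oner_eq0.
(* It remains to commute [a] and [b]. Term [n] has weight n + 1, hence the constant 8/(n + 1). *)
rewrite one_ba; apply: (asy_mulC _ _ (fun n => 8 * n.+1%:R^-1)).
  by rewrite -[X in _ --> X](mulr0 8); apply: cvgMr; exact: cvg_harmonic.
by move=> n x y; exact: bc_norm_commutator.
Qed.
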